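(* Let $\alpha=\{k_1,\dots,k_p\}$ (with $p\ge 2$) and $\beta=\{\widetilde k_1,\dots,\widetilde k_q\}$ be partitions of $N$ with $\alpha\sqsupseteq\beta$ (i.e. $\beta$ is a sub-partition of $\alpha$), let $\mathbf 1=\{1,1,\dots,1\}$ be the partition of $N$ into $N$ ones, and let $K_1,K_2$ be positive integers with $K_1+K_2=N$. Then $$\mathcal{FW}_2^N=\mathcal{FW}_{\mathbf 1,2}^N\subset \mathcal{FW}_{\beta,2}^N\subset\mathcal{FW}_{\alpha,2}^N\subset \mathcal{FW}^N_{\mathbf 1,\max_{i\neq j}\{k_i+k_j\}}\subset \mathcal{FW}^N_{\{K_1,K_2\},2}=\mathbb S_+^N ,$$ where $\subset$ denotes (not necessarily strict) inclusion.
   Context: $\mathbb S^n$ denotes the real symmetric $n\times n$ matrices and $\mathbb S^n_+$ the positive semidefinite ones. Partitions. A partition $\alpha=\{k_1,\dots,k_p\}$ of $N$ is an ordered list of positive integers with $\sum_{i=1}^p k_i=N$. For such $\alpha$, let $E_i=\begin{bmatrix}0&\cdots&I_{k_i}&\cdots&0\end{bmatrix}\in\mathbb R^{k_i\times N}$ be the $i$-th block row of the $N\times N$ identity matrix partitioned according to $\alpha$, and for $i\ne j$ let $E_{ij}=\begin{bmatrix}E_i^T& E_j^T\end{bmatrix}^T\in\mathbb R^{(k_i+k_j)\times N}$. Sub-partitions. For partitions $\alpha=\{k_1,\dots,k_{p_1}\}$ and $\beta=\{l_1,\dots,l_{p_2}\}$ of the same $N$ with $p_1<p_2$, write $\alpha\sqsupseteq\beta$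 ($\beta$ is a sub-partition of $\alpha$) if there are integers $1=m_1<m_2<\dots<m_{p_1+1}=p_2+1$ such that $k_i=\sum_{j=m_i}^{m_{i+1}-1} l_j$ for $i=1,\dots,p_1$. For example $\{4,2\}\sqsupseteq\{2,2,2\}\sqsupseteq\{1,1,1,1,1,1\}$. Factor-width-$k$ matrices. $\mathcal{FW}_k^N$ (also written $\mathcal{FW}_{\mathbf 1,k}^N$) is the set of matrices $X=\sum_{S} e_S^T X_S e_S$, where $S$ ranges over the $\binom Nk$ subsets of $\{1,\dots,N\}$ of size $k$, $e_S\in\mathbb R^{k\times N}$ is the matrix whose rows are the standard basis row vectors indexed by $S$ (in increasing order), and $X_S\in\mathbb S_+^k$. Block factor-width-two matrices. For a partition $\alpha=\{k_1,\dots,k_p\}$ of $N$, $\mathcal{FW}_{\alpha,2}^N$ is the set of matrices $X\in\mathbb S^N$ of the form $X=\sum_{i=1}^{p-1}\sum_{j=i+1}^p E_{ij}^TX_{ij}E_{ij}$ with $X_{ij}\in\mathbb S_+^{k_i+k_j}$. *)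

(* Defs.v *)
From mathcomp Require Import all_boot all_order all_algebra.
From mathcomp Require Import classical_sets reals.
Set Implicit Arguments.
Unset Strict Implicit.
Unset Printing Implicit Defensive.
Import Order.TTheory GRing.Theory Num.Theory.
Local Open Scope classical_set_scope.
Local Open Scope ring_scope.

Definition psdmx (R : realType) (n : nat) : set 'M[R]_n :=
  [set A | A \is symmetricmx /\
           forall x : 'cV[R]_n, 0 <= (x^T *m A *m x) ord0 ord0].

Definition is_partition_of (N : nat) (alpha : seq nat) : Prop :=
  all (fun k => 0 < k)%N alpha /\ sumn alpha = N.

Definition ones (N : nat) : seq nat := nseq N 1%N.

(* Block sizes and break points m are indexed from 0, so the conditions
   m_1 = 1 and m_(p1+1) = p2 + 1 on 1-based indices become m 0 = 0 and
   m (size alpha) = size beta. *)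
Definition subpartition (alpha beta : seq nat) : Prop :=
  (size alpha < size beta)%N /\
  exists m : nat -> nat,
    [/\ m 0%N = 0%N,
        m (size alpha) = size beta,
        forall i : nat, (i < size alpha)%N -> (m i < m i.+1)%N &
        forall i : nat, (i < size alpha)%N ->
          nth 0%N alpha i = (\sum_(m i <= j < m i.+1) nth 0%N beta j)%N].

Section FactorWidth.
Variable R : realType.

(* The 0/1 matrix e_S: 'enum_val' lists the elements of S increasingly. *)
Definition subset_rows (N : nat) (S : {set 'I_N}) : 'M[R]_(#|S|, N) :=
  rowsub (fun a : 'I_#|S| => enum_val a) 1%:M.

Definition factor_width (N k : nat) : set 'M[R]_N :=
  [set X | exists XS : forall S : {set 'I_N}, 'M[R]_#|S|,
     (forall S : {set 'I_N}, #|S| = k -> psdmx (XS S)) /\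
     X = \sum_(S : {set 'I_N} | #|S| == k)
           (subset_rows S)^T *m XS S *m subset_rows S].

(* Row a of the i-th block row of the identity is row k_0 + ... + k_(i-1) + a
   of the identity. *)
Definition block_row (N : nat) (alpha : seq nat) (i : nat) :
    'M[R]_(nth 0%N alpha i, N) :=
  \matrix_(a, b) ((b : nat) == sumn (take i alpha) + a)%N%:R.

Definition block_row2 (N : nat) (alpha : seq nat) (i j : nat) :
    'M[R]_(nth 0%N alpha i + nth 0%N alpha j, N) :=
  col_mx (block_row N alpha i) (block_row N alpha j).

Definition block_factor_width2 (N : nat) (alpha : seq nat) : set 'M[R]_N :=
  [set X | X \is symmetricmx /\
     exists XX : forall i j : nat, 'M[R]_(nth 0%N alpha i + nth 0%N alpha j),
     (forall i j : nat, (i < j < size alpha)%N -> psdmx (XX i j)) /\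
     X = \sum_(i < size alpha) \sum_(j < size alpha | (i < j)%N)
           (block_row2 N alpha i j)^T *m XX i j *m block_row2 N alpha i j].

End FactorWidth.

Definition max_pair_size (alpha : seq nat) : nat :=
  (\max_(i < size alpha) \max_(j < size alpha | i != j)
     (nth 0 alpha i + nth 0 alpha j))%N.

Arguments psdmx R n _ : clear implicits.
Arguments factor_width R N k _ : clear implicits.
Arguments block_factor_width2 R N alpha _ : clear implicits.

(* Main.v *)
(** [FW_k^N] and [FW_{alpha,2}^N] are both the set of finite sums of positive
    semidefinite matrices each supported on [S * S] for some [S] in a family of
    index sets: the [k]-subsets, resp. the unions of two blocks.  This holds
    because the [0/1] matrix [E] of such an [S] satisfies that [E^T E] is the
    coordinate projector on [S].  Every inclusion then follows from the fact that
    each set of one family is contained in a set of the next. *)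
Require Import Defs.
From mathcomp Require Import all_boot all_order all_algebra.
From mathcomp Require Import classical_sets reals.
From mathcomp Require Import zify.
Local Open Scope classical_set_scope.

Set Implicit Arguments.
Unset Strict Implicit.
Unset Printing Implicit Defensive.

(** * Closure properties of positive semidefinite matrices *)

Section Positivity.
Import fintype mathcomp.boot.finset.
Import Order.TTheory GRing.Theory Num.Theory.
Local Open Scope ring_scope.
Variable R : realType.

Lemma symmetricmxE (n : nat) (A : 'M[R]_n) : (A \is symmetricmx) = (A == A^T).
Proof. by rewrite is_hermitianmxE expr0 scale1r map_mx_id. Qed.

Lemma psdmx0 (n : nat) : psdmx R n 0.
Proof.
split; first by rewrite symmetricmxE trmx0.
by move=> x; rewrite mulmx0 mul0mx mxE.
Qed.

Lemma psdmxD (n : nat) (A B : 'M[R]_n) :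
  psdmx R n A -> psdmx R n B -> psdmx R n (A + B).
Proof.
rewrite /psdmx /= !symmetricmxE => -[/eqP sA pA] [/eqP sB pB]; split.
  by rewrite linearD /= -sA -sB.
by move=> x; rewrite mulmxDr mulmxDl mxE addr_ge0.
Qed.

Lemma psdmx_congr (m n : nat) (E : 'M[R]_(m, n)) (A : 'M[R]_m) :
  psdmx R m A -> psdmx R n (E^T *m A *m E).
Proof.
rewrite /psdmx /= !symmetricmxE => -[/eqP sA pA]; split.
  by rewrite !trmx_mul trmxK -sA mulmxA.
by move=> x; have := pA (E *m x); rewrite trmx_mul !mulmxA.
Qed.

Lemma psdmx_congr_tr (m n : nat) (E : 'M[R]_(m, n)) (A : 'M[R]_n) :
  psdmx R n A -> psdmx R m (E *m A *m E^T).
Proof. by move=> pA; have := psdmx_congr E^T pA; rewrite trmxK. Qed.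

(** * Cones of positive semidefinite matrices with prescribed supports *)

Section Cone.
Variable N : nat.
Implicit Types (S T : {set 'I_N}) (F G : {set 'I_N} -> Prop) (X Y : 'M[R]_N).

Definition supported S X := forall i j, X i j != 0 -> (i \in S) && (j \in S).

Definition set_proj S : 'M[R]_N := diag_mx (\row_j (j \in S)%:R).

Lemma supportedS S T X : S \subset T -> supported S X -> supported T X.
Proof.
by move=> /subsetP sST sX i j /sX /andP[iS jS]; rewrite !sST.
Qed.

Lemma supported_proj S X : supported S X -> set_proj S *m X *m set_proj S = X.
Proof.
move=> sX; apply/matrixP=> i j.
rewrite mul_mx_diag mxE mul_diag_mx !mxE.
have [->|/sX /andP[-> ->]] := eqVneq (X i j) 0; first by rewrite mulr0 mul0r.
by rewrite mul1r mulr1.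
Qed.

(** The diagonal entry of [E^T *m E] at [j] is the sum of the squares of column [j]; for [j] outside
    [S] it is zero, so every square vanishes. *)
Lemma gram_proj_col0 (m : nat) (E : 'M[R]_(m, N)) S (a : 'I_m) j :
  E^T *m E = set_proj S -> j \notin S -> E a j = 0.
Proof.
move=> /matrixP/(_ j j); rewrite !mxE eqxx mulr1n => sum0 jS.
move: sum0; rewrite (negbTE jS) /=.
under eq_bigr do rewrite mxE.
move=> /eqP; rewrite psumr_eq0 => [|b _]; last by rewrite -expr2 sqr_ge0.
move=> /allP/(_ a (mem_index_enum _)) /=.
by rewrite mulf_eq0 orbb => /eqP.
Qed.

Lemma supported_congr (m : nat) (E : 'M[R]_(m, N)) (A : 'M[R]_m) S :
  E^T *m E = set_proj S -> supported S (E^T *m A *m E).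
Proof.
move=> ES i j; apply: contraR; rewrite negb_and => /orP[iS|jS].
  rewrite -mulmxA mxE big1 // => a _.
  by rewrite mxE (gram_proj_col0 a ES iS) mul0r.
by rewrite mxE big1 // => a _; rewrite (gram_proj_col0 a ES jS) mulr0.
Qed.

(** The summands are unindexed and several may share one set, so stability under sums and under a
    change of family are plain inductions. *)
Inductive psd_cone F : 'M[R]_N -> Prop :=
| psd_cone0 : psd_cone F 0
| psd_cone_cons S Y X :
    F S -> psdmx R N Y -> supported S Y -> psd_cone F X -> psd_cone F (Y + X).

Lemma psd_cone1 F S Y : F S -> psdmx R N Y -> supported S Y -> psd_cone F Y.
Proof.
by move=> FS pY sY; rewrite -[Y]addr0; apply: psd_cone_cons FS _ _ _ => //; left.
Qed.

Lemma psd_coneD F X Y : psd_cone F X -> psd_cone F Y -> psd_cone F (X + Y).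
Proof.
move=> cX cY; elim: cX => [|S A B FS pA sA _ IH]; first by rewrite add0r.
by rewrite -addrA; apply: psd_cone_cons FS _ _ _.
Qed.

Lemma psd_coneS F G X :
  (forall S, F S -> exists2 T, G T & S \subset T) ->
  psd_cone F X -> psd_cone G X.
Proof.
move=> FG; elim=> [|S Y Z FS pY sY _ IH]; first by left.
have [T GT sST] := FG _ FS.
by apply: psd_cone_cons GT _ _ IH => //; apply: supportedS sY.
Qed.

Lemma psd_cone_psdmx F X : psd_cone F X -> psdmx R N X.
Proof.
by elim=> [|S Y Z _ pY _ _ pZ]; [apply: psdmx0 | apply: psdmxD].
Qed.

(** Passes between free sums and sums with exactly one coefficient per index. A summand [Y]
    supported on [B i] equals [E^T (E Y E^T) E] because [E^T E] is the projector on [B i], so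
    [E Y E^T] can be added to the coefficient at [i]. *)
Lemma psd_cone_sumP (I : eqType) (r : seq I) (d : I -> nat)
    (E : forall i, 'M[R]_(d i, N)) (B : I -> {set 'I_N}) X :
  uniq r -> (forall i, i \in r -> (E i)^T *m E i = set_proj (B i)) ->
  psd_cone (fun S => exists2 i, i \in r & S = B i) X <->
  exists A : forall i, 'M[R]_(d i),
    (forall i, i \in r -> psdmx R (d i) (A i)) /\
    X = \sum_(i <- r) (E i)^T *m A i *m E i.
Proof.
move=> ur EB; split.
- elim=> [|S Y Z [i ir ->] pY sY _ [A [pA ->]]].
    exists (fun=> 0); split=> [i _|]; first exact: psdmx0.
    by rewrite big1 // => i _; rewrite mulmx0 mul0mx.
  (* The new summand changes the coefficient at the single index [i]. *)
  pose D j := if j == i then E j *m Y *m (E j)^T else 0.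
  exists (fun j => D j + A j); split=> [j jr|].
    apply: psdmxD (pA _ jr); rewrite /D; case: eqP => _; last exact: psdmx0.
    exact: psdmx_congr_tr.
  under [RHS]eq_bigr do rewrite mulmxDr mulmxDl.
  rewrite big_split /=; congr (_ + _).
  rewrite (bigD1_seq i) //= big1 ?addr0 => [|j /negbTE ji]; last first.
    by rewrite /D ji mulmx0 mul0mx.
  rewrite /D eqxx !mulmxA EB // -!mulmxA EB // mulmxA.
  by rewrite supported_proj.
- move=> [A [pA ->]]; rewrite big_seq.
  apply: (big_ind (psd_cone _)) => [|Y Z|i ir]; first by left.
    exact: psd_coneD.
  apply: (@psd_cone1 _ (B i)); first by exists i.
    by apply: psdmx_congr; apply: pA.
  by apply: supported_congr; apply: EB.
Qed.

(** In the sum for row [i] of the product, only the term at the rank of [i] in [S] can be nonzero;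
    there is no such term when [i] is outside [S]. *)
Lemma gram_subset_rows S :
  (subset_rows R S)^T *m subset_rows R S = set_proj S.
Proof.
apply/matrixP=> i j; rewrite !mxE.
under eq_bigr do rewrite !mxE.
have [iS|iS] := boolP (i \in S); last first.
  rewrite mul0rn big1 // => a _; case: eqP => [ai|]; last by rewrite mul0r.
  by case/negP: iS; rewrite -ai enum_valP.
rewrite (bigD1 (enum_rank_in iS i)) //= enum_rankK_in // eqxx mul1r.
rewrite big1 ?addr0 // => a ai; case: eqP => [e|]; last by rewrite mul0r.
by case/eqP: ai; apply: enum_val_inj; rewrite enum_rankK_in.
Qed.

Lemma factor_widthE (k : nat) :
  factor_width R N k = psd_cone (fun S => #|S| = k).
Proof.
apply/seteqP.
(* The [k]-subsets serve as their own indices, hence [B] is [id]. *)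
have cP X := @psd_cone_sumP _ (enum [pred S : {set 'I_N} | #|S| == k]) _
  (@subset_rows R N) id X (enum_uniq _) (fun S _ => gram_subset_rows S).
split=> X /=.
- move=> [XS [pXS XE]].
  have /cP : exists A : forall S, 'M[R]_#|S|,
      (forall S, S \in enum [pred S : {set 'I_N} | #|S| == k] ->
         psdmx R #|S| (A S)) /\
      X = \sum_(S <- enum [pred S : {set 'I_N} | #|S| == k])
            (subset_rows R S)^T *m A S *m subset_rows R S.
    exists XS; split; last by rewrite big_enum.
    by move=> S; rewrite mem_enum inE => /eqP; apply: pXS.
  apply: psd_coneS => S [T]; rewrite mem_enum inE => /eqP Tk ->.
  by exists T.
- move=> cX.
  have /cP[A [pA ->]] : psd_cone (fun S => exists2 T,
      T \in enum [pred S : {set 'I_N} | #|S| == k] & S = T) X.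
    apply: psd_coneS cX => S Sk; exists S => //; exists S => //.
    by rewrite mem_enum inE; apply/eqP.
  exists A; split; last by rewrite big_enum.
  by move=> S Sk; apply: pA; rewrite mem_enum inE; apply/eqP.
Qed.

End Cone.
End Positivity.

(** * Blocks of a partition, their pairwise unions, and sub-partitions *)

Section Blocks.
Import fintype mathcomp.boot.finset.
Implicit Types alpha beta : seq nat.

Definition block (N : nat) alpha (i : nat) : {set 'I_N} :=
  [set b : 'I_N | sumn (take i alpha) <= b < sumn (take i.+1 alpha)].

Definition block_pair (N : nat) alpha (S : {set 'I_N}) : Prop :=
  exists i j, i < j < size alpha /\ S = block N alpha i :|: block N alpha j.

Lemma sumn_takeS alpha i :
  sumn (take i.+1 alpha) = sumn (take i alpha) + nth 0 alpha i.
Proof.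
elim: alpha i => [|k alpha IH] [|i] //=; first by rewrite take0 /= addn0 add0n.
by rewrite IH addnA.
Qed.

Lemma sumn_take_leq alpha i j :
  i <= j -> sumn (take i alpha) <= sumn (take j alpha).
Proof.
move=> /subnK <-; elim: (j - i) => [|n IH]; first by rewrite add0n.
by rewrite addSn sumn_takeS (leq_trans IH) ?leq_addr.
Qed.

Lemma gram_block_row (R : realType) (N : nat) alpha i (b c : 'I_N) :
  (((block_row R N alpha i)^T *m block_row R N alpha i) b c
   = ((b == c) && (b \in block N alpha i))%:R)%R.
Proof.
rewrite !mxE; under eq_bigr do rewrite !mxE.
rewrite inE sumn_takeS.
have [/andP[le_b lt_b]|bNi] := boolP (_ <= b < _).
  (* Column [b] of the block row has its only 1 in the row given by the offset of [b] within the
     block. *)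
  have lt_b' : b - sumn (take i alpha) < nth 0 alpha i by lia.
  rewrite (bigD1 (Ordinal lt_b')) //= big1 => [|a /eqP ab].
    rewrite GRing.addr0 subnKC // eqxx GRing.mul1r andbT.
    by rewrite -val_eqE /= eq_sym.
  case: eqP => [be|]; last by rewrite GRing.mul0r.
  by case: ab; apply/val_inj => /=; rewrite be addKn.
rewrite andbF big1 // => a _; case: eqP => [be|]; last by rewrite GRing.mul0r.
by case/negP: bNi; rewrite be leq_addr ltn_add2l ltn_ord.
Qed.

(** Stacking adds the Gram matrices. For [i < j] the blocks are disjoint, so their indicators add up
    to that of the union. *)
Lemma gram_block_row2 (R : realType) (N : nat) alpha i j :
  i < j ->
  ((block_row2 R N alpha i j)^T *m block_row2 R N alpha i j
   = set_proj R (block N alpha i :|: block N alpha j))%R.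
Proof.
move=> lt_ij; apply/matrixP=> b c.
rewrite /block_row2 tr_col_mx mul_row_col mxE !gram_block_row !mxE !inE.
have := sumn_take_leq alpha lt_ij.
case: (eqVneq b c) => _ le_ij /=; last by rewrite GRing.addr0.
case: (boolP (_ <= b < _)) => [/andP[_ b1]|_] /=; last by rewrite GRing.add0r.
by rewrite leqNgt (leq_trans b1 le_ij) GRing.addr0.
Qed.

Lemma block_factor_width2E (R : realType) (N : nat) alpha :
  block_factor_width2 R N alpha = psd_cone (@block_pair N alpha).
Proof.
pose p := size alpha.
(* The double sum over [i < j] is flattened to one duplicate-free list of pairs, the form that
   [psd_cone_sumP] expects. *)
pose r := [seq ij <- [seq (i, j) | i <- index_iota 0 p, j <- index_iota 0 p]
             | ij.1 < ij.2].
have memr ij : (ij \in r) = (ij.1 < ij.2 < p).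
  case: ij => i j; rewrite mem_filter /=.
  case: ltnP => //= lt_ij; apply/allpairsP/idP => [[[a b]] /=|lt_j].
    by rewrite !mem_index_iota => -[_ lt_b [_ ->]].
  by exists (i, j); rewrite !mem_index_iota /= lt_j (ltn_trans lt_ij).
have ur : uniq r.
  by rewrite filter_uniq // allpairs_uniq ?iota_uniq // => -[? ?] [? ?].
have rE (F : nat -> nat -> 'M[R]_N) :
    (\sum_(i < p) \sum_(j < p | (i < j)%N) F i j = \sum_(ij <- r) F ij.1 ij.2)%R.
  rewrite big_filter [RHS]big_mkcond big_allpairs_dep /=.
  rewrite big_mkord; apply: eq_bigr => i _.
  by rewrite big_mkord -big_mkcond.
have cP X := @psd_cone_sumP R N _ r
  (fun ij => nth 0 alpha ij.1 + nth 0 alpha ij.2)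
  (fun ij => block_row2 R N alpha ij.1 ij.2)
  (fun ij => block N alpha ij.1 :|: block N alpha ij.2) X ur.
have Egram ij : ij \in r ->
    ((block_row2 R N alpha ij.1 ij.2)^T *m block_row2 R N alpha ij.1 ij.2
     = set_proj R (block N alpha ij.1 :|: block N alpha ij.2))%R.
  by rewrite memr => /andP[lt_ij _]; apply: gram_block_row2.
apply/seteqP; split=> X /=.
- move=> [_ [XX [pXX ->]]].
  rewrite (rE (fun i j => (block_row2 R N alpha i j)^T *m XX i j
                            *m block_row2 R N alpha i j)%R).
  apply: (@psd_coneS _ _ (fun S => exists2 ij, ij \in r
            & S = block N alpha ij.1 :|: block N alpha ij.2)).
    move=> S [[i j]]; rewrite memr => lt_ij ->.
    by exists (block N alpha i :|: block N alpha j) => //; exists i, j.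
  apply/cP => //; exists (fun ij => XX ij.1 ij.2); split=> //.
  by move=> ij; rewrite memr; apply: pXX.
- move=> cX; split; first by have [] := psd_cone_psdmx cX.
  have /cP[//|A [pA ->]] : psd_cone (fun S => exists2 ij, ij \in r
            & S = block N alpha ij.1 :|: block N alpha ij.2) X.
    apply: psd_coneS cX => S [i [j [lt_ij ->]]].
    by exists (block N alpha i :|: block N alpha j) => //;
      exists (i, j); rewrite ?memr.
  exists (fun i j => A (i, j)); split.
    by move=> i j lt_ij; apply: (pA (i, j)); rewrite memr.
  rewrite (rE (fun i j => (block_row2 R N alpha i j)^T *m A (i, j)
                            *m block_row2 R N alpha i j)%R).
  by apply: eq_bigr => -[].
Qed.

(** Descending from [n], the first index whose value is at most [x] works. Applied to prefix sums it
    finds the block of an index; applied to break points, the coarse block of a fine one. *)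
Lemma exists_step (f : nat -> nat) n x :
  f 0 <= x < f n -> exists2 i, i < n & f i <= x < f i.+1.
Proof.
move=> /andP[f0x]; elim: n => [|n IH] lt_x; first by lia.
have [/IH[i lt_i fi]|le_x] := ltnP x (f n); first by exists i => //; lia.
by exists n; rewrite ?le_x.
Qed.

Lemma mem_block (N : nat) alpha (b : 'I_N) :
  sumn alpha = N -> exists2 i, i < size alpha & b \in block N alpha i.
Proof.
move=> sN.
have [|i lt_i bi] := @exists_step (fun i => sumn (take i alpha)) (size alpha) b.
  by rewrite take0 take_size sN /=.
by exists i => //; rewrite inE.
Qed.

(** The case that needs care is [i = j]: any other block then completes the pair, and
    [2 <= size alpha] provides one. *)
Lemma block_pair_cover (N : nat) alpha (A B : {set 'I_N}) i j :
  2 <= size alpha -> i < size alpha -> j < size alpha ->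
  A \subset block N alpha i -> B \subset block N alpha j ->
  exists2 T, block_pair alpha T & A :|: B \subset T.
Proof.
move=> s2; wlog le_ij : i j A B / i <= j.
  move=> IH i_s j_s Ai Bj; case: (leqP i j) => [|/ltnW] le; first exact: (IH i j).
  by rewrite setUC; apply: (IH j i).
move=> i_s j_s Ai Bj.
case: (ltngtP i j) le_ij => // [lt_ij|eij] _.
  exists (block N alpha i :|: block N alpha j); last exact: setUSS.
  by exists i, j; rewrite lt_ij.
(* The partner is block 0, or block 1 when [i] is itself 0. *)
rewrite -eij in Bj; case: (posnP i) => [i0|i_gt0].
  exists (block N alpha 0 :|: block N alpha 1); first by exists 0, 1.
  by rewrite subsetU // -i0 subUset Ai Bj.
exists (block N alpha 0 :|: block N alpha i); first by exists 0, i; rewrite i_gt0.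
by rewrite subsetU // orbC subUset Ai Bj.
Qed.

Lemma block_ones_subset (N : nat) (b : 'I_N) : block N (ones N) b = [set b].
Proof.
apply/setP=> c; rewrite !inE /ones !take_nseq ?(ltnW (ltn_ord b)) //.
by rewrite !sumn_nseq !mul1n ltnS -eqn_leq eq_sym.
Qed.

Lemma block_pair_ones (N : nat) (S : {set 'I_N}) :
  block_pair (ones N) S <-> #|S| = 2.
Proof.
split=> [[i [j []]]|/eqP/cards2P[b [c [bc ->]]]].
  rewrite size_nseq => /andP[lt_ij lt_jN] ->.
  (* The block numbers are recast as elements of ['I_N], since here block [b] is the singleton of
     [b]. *)
  rewrite -[i]/(val (Ordinal (ltn_trans lt_ij lt_jN))) -[j]/(val (Ordinal lt_jN)).
  by rewrite !block_ones_subset cards2 -val_eqE /= neq_ltn lt_ij.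
wlog lt_bc : b c bc / b < c.
  move=> IH; move: (bc); rewrite -val_eqE neq_ltn => /orP[|lt_cb].
    exact: IH.
  by rewrite setUC; apply: IH lt_cb; rewrite eq_sym.
by exists b, c; rewrite !block_ones_subset size_nseq lt_bc ltn_ord.
Qed.

(** Prefix sums of [alpha] are the prefix sums of [beta] at the break points, and [l] lies between
    two consecutive break points. *)
Lemma subpartition_block (N : nat) alpha beta l :
  subpartition alpha beta -> l < size beta ->
  exists2 i, i < size alpha & block N beta l \subset block N alpha i.
Proof.
move=> [_ [m [m0 mp mS mk]]] lt_l.
have sE i : i <= size alpha -> sumn (take i alpha) = sumn (take (m i) beta).
  elim: i => [|i IH] lt_i; first by rewrite m0 !take0.
  rewrite sumn_takeS mk // IH; last exact: ltnW.
  (* Induction on the right end of the range of [beta]; strict increase of [m] makes a range of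
     length one the base case. *)
  have := mS i lt_i; elim: (m i.+1) => // n IHn; rewrite ltnS leq_eqVlt.
  case/predU1P=> [->|lt_n]; first by rewrite big_nat1 sumn_takeS.
  by rewrite big_nat_recr 1?ltnW //= addnA IHn // sumn_takeS.
have [|i lt_i /andP[le_m lt_m]] := @exists_step m (size alpha) l.
  by rewrite m0 mp.
exists i => //; apply/subsetP=> b; rewrite !inE !sE //; last exact: ltnW.
have := sumn_take_leq beta le_m; have := sumn_take_leq beta lt_m.
by lia.
Qed.

(** Only an inequality, because [block] keeps just the part of the interval below [N]. *)
Lemma card_block (N : nat) alpha i : #|block N alpha i| <= nth 0 alpha i.
Proof.
rewrite cardE -(size_map val) -(size_iota (sumn (take i alpha)) (nth 0 alpha i)).
apply: uniq_leq_size; first by rewrite (map_inj_uniq val_inj) enum_uniq.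
move=> _ /mapP[b + ->]; rewrite mem_enum inE sumn_takeS.
by rewrite mem_iota.
Qed.

(** Two distinct blocks contribute two distinct terms to the total. This bound ensures that ['I_N]
    has subsets of size [max_pair_size alpha]. *)
Lemma max_pair_size_leq alpha : max_pair_size alpha <= sumn alpha.
Proof.
apply/bigmax_leqP => i _; apply/bigmax_leqP => j ij.
rewrite sumnE (big_nth 0) big_mkord (bigD1 i) //= leq_add2l.
by rewrite (bigD1 j) 1?eq_sym //= leq_addr.
Qed.

Lemma leq_max_pair_size alpha i j :
  i < j < size alpha ->
  nth 0 alpha i + nth 0 alpha j <= max_pair_size alpha.
Proof.
move=> /andP[lt_ij lt_j].
have ij : Ordinal (ltn_trans lt_ij lt_j) != Ordinal lt_j.
  by rewrite -val_eqE /= neq_ltn lt_ij.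
rewrite /max_pair_size (bigD1 (Ordinal (ltn_trans lt_ij lt_j))) //=.
by rewrite (bigD1 (Ordinal lt_j)) //= -maxnA leq_maxl.
Qed.

(** Elements outside the set are adjoined one at a time; the bound by [#|T|] guarantees that one is
    left. *)
Lemma subset_of_card (T : finType) (A : {set T}) k :
  #|A| <= k <= #|T| -> exists2 B : {set T}, #|B| = k & A \subset B.
Proof.
move=> /andP[/subnKC <-]; elim: (k - #|A|) => [|n IH] leT.
  by exists A; rewrite ?addn0.
have [|B cB AB] := IH; first by apply: leq_trans leT; rewrite leq_add2l.
have [x xB] : exists x, x \notin B.
  apply/existsP; rewrite -[[exists _, _]]negbK negb_exists.
  apply: contraTN leT => /forallP BT; rewrite -ltnNge addnS -cB ltnS.
  by apply: subset_leq_card; apply/subsetP=> x _; rewrite -[_ \in _]negbK.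
exists (x |: B); first by rewrite cardsU1 xB cB addnS.
by rewrite subsetU // AB orbT.
Qed.

End Blocks.

Theorem theorem1 (R : realType) (N : nat) (alpha beta : seq nat) (K1 K2 : nat)
  (halpha : is_partition_of N alpha) (hp : (2 <= size alpha)%N)
  (hbeta : is_partition_of N beta) (hsub : subpartition alpha beta)
  (hK1 : (0 < K1)%N) (hK2 : (0 < K2)%N) (hK : (K1 + K2)%N = N) :
  factor_width R N 2 = block_factor_width2 R N (ones N) /\
  block_factor_width2 R N (ones N) `<=` block_factor_width2 R N beta /\
  block_factor_width2 R N beta `<=` block_factor_width2 R N alpha /\
  block_factor_width2 R N alpha `<=` factor_width R N (max_pair_size alpha) /\
  factor_width R N (max_pair_size alpha)
    `<=` block_factor_width2 R N [:: K1; K2] /\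
  block_factor_width2 R N [:: K1; K2] = psdmx R N.
Proof.
have hq : 2 <= size beta by case: hsub => lt_pq _; apply: ltnW (leq_ltn_trans hp lt_pq).
(* The two blocks of [[:: K1; K2]] fill the whole index set, so this family contains a superset of
   every support. *)
have sT : block_pair [:: K1; K2] [set: 'I_N]%SET.
  exists 0, 1; split=> //; apply/setP=> b; rewrite !inE /= !addn0.
  by have := ltn_ord b; rewrite -[in X in _ < X]hK; lia.
rewrite !factor_widthE !block_factor_width2E; do !split.
- apply/seteqP; split=> X; apply: psd_coneS => S hS; exists S => //;
    exact/block_pair_ones.
- move=> X; apply: psd_coneS => S [i [j []]]; rewrite size_nseq => /andP[lt_ij lt_j] ->.
  pose b := Ordinal (ltn_trans lt_ij lt_j); pose c := Ordinal lt_j.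
  (* The blocks of [beta] containing [b] and [c] may coincide; [block_pair_cover] handles this, and
     likewise for the blocks of [alpha] in the next inclusion. *)
  have [k lt_k bk] := mem_block b (proj2 hbeta).
  have [l lt_l cl] := mem_block c (proj2 hbeta).
  by apply: (block_pair_cover hq lt_k lt_l);
    rewrite -?[i]/(val b) -?[j]/(val c) block_ones_subset finset.sub1set.
- move=> X; apply: psd_coneS => S [i [j [/andP[lt_ij lt_j] ->]]].
  have [k lt_k ik] := subpartition_block N hsub (ltn_trans lt_ij lt_j).
  have [l lt_l jl] := subpartition_block N hsub lt_j.
  exact: (block_pair_cover hp lt_k lt_l).
(* A union of two blocks has at most [max_pair_size alpha] elements, and is enlarged to a set of
   exactly that size. *)
- move=> X; apply: psd_coneS => S [i [j [lt_ij ->]]]; apply: subset_of_card.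
  rewrite card_ord -(proj2 halpha) max_pair_size_leq andbT (proj2 halpha).
  apply: leq_trans (leq_max_pair_size lt_ij).
  by apply: leq_trans (leq_card_setU _ _) (leq_add (card_block _ _ _) (card_block _ _ _)).
- by move=> X; apply: psd_coneS => S _; exists [set: 'I_N]%SET => //; apply: finset.subsetT.
- apply/seteqP; split=> X; first exact: psd_cone_psdmx.
  (* A positive semidefinite matrix is a single summand supported on the full index set. *)
  by move=> pX; apply: psd_cone1 sT pX _ => i j; rewrite !inE.
Qed.
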